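(* Let $V$ be a finite-dimensional vector space over $\mathrm{GF}(2)$, let $\rho$ be a permutation of $V$, and let $G = \langle\, \rho\sigma_k : k \in V \,\rangle \le \mathrm{Sym}(V)$ be the group generated by the round functions of the corresponding key-alternating block cipher. Suppose $G$ acts imprimitively on $V$. Then the blocks of imprimitivity are the translates of a linear subspace; that is, for every block system $\mathcal{B}$ for the action of $G$ on $V$ there is a linear subspace $U$ of $V$ such that $\mathcal{B} = \{\, v + U : v \in V \,\}$.
   Context: Maps are written on the right and composed left to right: $v\,\rho\sigma_k = (v\rho)\sigma_k$. For $v \in V$, $\sigma_v : V \to V$ is the translation $w \mapsto w + v$. The round functions of the key-alternating block cipher are the permutations $\rho\sigma_k$ of the message space $V$, with $\rho$ a fixed (arbitrary) permutation of $V$ and $k\in V$ a round key. (The group $G$ contains all translations, hence is transitive on $V$.) A partition $\mathcal{B}$ of $V$ (a family of nonempty subsets such that each element of $V$ lies in exactly one of them) is $G$-invariant if $Bg \in \mathcal{B}$ for all $B \in \mathcal{B}$, $g \in G$. It is trivial if $\mathcal{B} = \{V\}$ or $\mathcal{B} = \{\{\alpha\} : \alpha \in V\}$. A block system for $G$ is a non-trivial $G$-invariant partition of $V$; its elements are called blocks (of imprimitivity). $G$ acts imprimitively on $V$ if a block system exists, and is primitive otherwise. *)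

(* Defs.v *)
From HB Require Import structures.
From mathcomp Require Export all_boot all_fingroup all_algebra all_solvable all_field.

Set Implicit Arguments.
Unset Strict Implicit.
Unset Printing Implicit Defensive.

Import GRing.Theory.

(* [finvect_type V] is [V] itself, equipped with the finType structure that it
   has because 'F_2 is finite; this is what makes {perm _} available. *)
Definition translation (V : vectType 'F_2) (v : finvect_type V) :
    {perm finvect_type V} :=
  perm (@addIr _ v : injective (fun w : finvect_type V => (w + v)%R)).

(* In mathcomp permutations also compose from left to right:
   (s * t)%g x = t (s x). *)
Definition round_function (V : vectType 'F_2) (rho : {perm finvect_type V})
    (k : finvect_type V) : {perm finvect_type V} :=
  (rho * translation k)%g.

Definition round_group (V : vectType 'F_2) (rho : {perm finvect_type V}) :
    {group {perm finvect_type V}} :=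
  <<[set round_function rho k | k : finvect_type V]>>%G.

(* Block systems are the library's [imprimitivity_system]s for the natural
   action 'P; see [block_systemP] for the element-wise reading. *)
Definition block_system (V : vectType 'F_2)
    (G : {group {perm finvect_type V}}) (B : {set {set finvect_type V}}) : bool :=
  imprimitivity_system G [set: finvect_type V] 'P B.

Definition acts_imprimitively (V : vectType 'F_2)
    (G : {group {perm finvect_type V}}) : Prop :=
  exists B, block_system G B.

Definition translate (V : vectType 'F_2) (v : finvect_type V)
    (U : {vspace V}) : {set finvect_type V} :=
  [set (v + u)%R | u : finvect_type V in U].

Lemma translationE (V : vectType 'F_2) (v w : finvect_type V) :
  translation v w = (w + v)%R.
Proof. by rewrite permE. Qed.

Lemma round_functionE (V : vectType 'F_2) (rho : {perm finvect_type V})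
    (k v : finvect_type V) :
  round_function rho k v = (rho v + k)%R.
Proof. by rewrite permM translationE. Qed.

Lemma block_systemP (V : vectType 'F_2) (G : {group {perm finvect_type V}})
    (B : {set {set finvect_type V}}) :
  block_system G B <->
  [/\ partition B [set: finvect_type V],
      forall X (g : {perm finvect_type V}), X \in B -> g \in G -> g @: X \in B,
      B <> [set [set: finvect_type V]]
    & B <> [set [set x] | x : finvect_type V]].
Proof.
have cardS : #|[set [set x] | x : finvect_type V]| = #|[set: finvect_type V]|.
  by rewrite card_imset ?cardsT //; apply: set1_inj.
rewrite /block_system /imprimitivity_system; split.
  case/and3P=> pB aB /andP[B1 BV]; split=> // [X g BX Gg||].
  - by have := actsP aB g Gg X; rewrite BX; apply.
  - by move=> eB; rewrite eB cards1 in B1.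
  - by move=> eB; rewrite eB cardS ltnn in BV.
case=> pB aB nT nS; apply/and3P; split=> //.
  apply/subsetP=> g Gg; rewrite !inE; apply/subsetP=> X BX.
  by rewrite inE; apply: aB.
case/and3P: (pB) => /eqP cB tB n0.
have block x : exists2 X, X \in B & x \in X.
  by have := in_setT x; rewrite -cB => /bigcupP[X BX Xx]; exists X.
apply/andP; split.
  rewrite ltnNge; apply/negP=> B1; apply: nT.
  have [X BX _] := block 0%R.
  have eB : B = [set X].
    by apply/esym/eqP; rewrite eqEcard sub1set BX cards1.
  by move: cB; rewrite eB /cover big_set1 => <-.
rewrite -cardS ltnNge; apply/negP=> SB; apply: nS.
pose f (X : {set finvect_type V}) := odflt 0%R [pick x in X] : finvect_type V.
have fX X : X \in B -> f X \in X.
  move=> BX; rewrite /f; case: pickP => //= X0.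
  case/negP: n0; rewrite -(_ : X = set0) //; apply/setP=> x.
  by rewrite X0 inE.
have pbB X x : X \in B -> x \in X -> pblock B x = X by move=> *; apply: def_pblock.
have f_inj : {in B &, injective f}.
  by move=> X Y BX BY eXY; rewrite -(pbB X (f X)) ?fX // eXY (pbB Y) ?fX.
have fB : f @: B = [set: finvect_type V].
  apply/eqP; rewrite eqEcard subsetT (card_in_imset f_inj) -cardS.
  exact: SB.
have B1 X x : X \in B -> x \in X -> X = [set x].
  move=> BX Xx; apply/setP=> y; rewrite inE.
  have E z : z \in X -> z = f X.
    move=> Xz; have : z \in f @: B by rewrite fB inE.
    case/imsetP=> Y BY ez.
    have YX : Y = X by rewrite -(pbB Y z) ?(pbB X z) // ez fX.
    by rewrite ez YX.
  apply/idP/eqP=> [Xy|->//]; by rewrite (E y) // (E x).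
apply/setP=> X; apply/idP/imsetP=> [BX|[x _ ->]].
  by exists (f X) => //; apply: B1; rewrite ?fX.
by have [X' BX' Xx] := block x; rewrite -(B1 X' x).
Qed.

(* Main.v *)
Require Import Defs.

Set Implicit Arguments.
Unset Strict Implicit.
Unset Printing Implicit Defensive.

Import GRing.Theory.
Local Open Scope ring_scope.

(** Although each round function involves the arbitrary permutation [rho], a
    quotient of two of them does not: [(rho sigma_0)^-1 (rho sigma_k)] is the
    translation [sigma_k]. So the group contains every translation
    ([translation_in_round_group]), and the invariance of a block system under
    translations is all that matters.

    Two blocks that meet are equal. Hence, if [A] is the block of 0, then a block
    [X] containing [v] is [A + v], because both blocks contain [v]
    ([block_eq_zero_block_shift]). In particular [A + u = A] for [u] in [A], so
    [A] is closed under addition. Over a prime field every scalar is a multiple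
    of 1, so [A] is a linear subspace ([addr_closed_is_vspace]), and the blocks
    are its translates. *)

(** Scaling by an element of a prime field is repeated addition, so closure
    under addition already gives closure under linear combinations. *)
Lemma addr_closed_is_vspace (p : nat) (V : vectType 'F_p)
    (A : {set finvect_type V}) :
  0 \in A -> (forall u v, u \in A -> v \in A -> u + v \in A) ->
  exists U : {vspace V}, forall v : finvect_type V, (v \in U) = (v \in A).
Proof.
move=> A0 AD.
have enumE (w : finvect_type V) : (w \in (enum A : seq V)) = (w \in A).
  exact: mem_enum.
exists <<(enum A : seq V)>>%VS => v; apply/idP/idP => [|Av]; last first.
  by apply: memv_span; rewrite enumE.
move/(@coord_span _ _ _ (in_tuple (enum A : seq V))) => ->.
apply: (big_ind (fun x : finvect_type V => x \in A)) => // i _.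
rewrite -[coord _ _ _]natr_Zp scaler_nat.
have Ai : ((enum A)`_i : finvect_type V) \in A.
  by rewrite -mem_enum; apply: mem_nth.
have AMn n : ((enum A)`_i : finvect_type V) *+ n \in A.
  by elim: n => [|n IHn]; rewrite ?mulr0n // mulrS AD.
exact: AMn.
Qed.

Lemma translation_in_round_group (V : vectType 'F_2)
    (rho : {perm finvect_type V}) (k : finvect_type V) :
  translation k \in round_group rho.
Proof.
have -> : translation k = ((round_function rho 0)^-1 * round_function rho k)%g.
  apply: (mulgI (round_function rho 0)); rewrite mulKVg.
  by apply/permP => v; rewrite permM translationE !round_functionE addr0.
by rewrite groupM ?groupV //; apply: mem_gen; apply: imset_f.
Qed.

(** The image of [A] under [translation v] is a block that shares the point
    [0 + v] with [X], and blocks that meet coincide. *)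
Lemma block_eq_zero_block_shift (V : vectType 'F_2)
    (B : {set {set finvect_type V}}) (A X : {set finvect_type V})
    (v : finvect_type V) :
  trivIset B -> (forall Y k, Y \in B -> translation k @: Y \in B) ->
  A \in B -> 0 \in A -> X \in B -> v \in X -> translation v @: A = X.
Proof.
move=> tB invB BA A0 BX Xv.
have Av : v \in translation v @: A.
  by apply/imsetP; exists 0; rewrite // translationE add0r.
by rewrite -(def_pblock tB (invB _ v BA) Av) (def_pblock tB BX Xv).
Qed.

Theorem theorem3p1 (V : vectType 'F_2) (rho : {perm finvect_type V})
    (hG : acts_imprimitively (round_group rho))
    (B : {set {set finvect_type V}})
    (hB : block_system (round_group rho) B) :
  exists U : {vspace V}, B = [set translate v U | v : finvect_type V].
Proof.
case/block_systemP: hB => /and3P[/eqP cB tB n0] invG _ _.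
have invB Y k : Y \in B -> translation k @: Y \in B.
  by move=> BY; apply: invG => //; apply: translation_in_round_group.
have [A BA A0] : exists2 A, A \in B & 0 \in A.
  by have := in_setT (0 : finvect_type V); rewrite -cB => /bigcupP[A]; exists A.
have shift X v : X \in B -> v \in X -> translation v @: A = X.
  exact: block_eq_zero_block_shift.
have [|U UA] := addr_closed_is_vspace A0.
  move=> u v Au Av; rewrite -(shift A v BA Av).
  by apply/imsetP; exists u; rewrite ?translationE.
have tE v : translate v U = translation v @: A.
  apply/setP => w; apply/imsetP/imsetP => -[u Uu ->]; exists u;
    by rewrite ?translationE 1?addrC ?UA // -UA.
exists U; apply/setP => X; apply/idP/imsetP => [BX|[v _ ->]]; last first.
  by rewrite tE; apply: invB.
have /set0Pn[v Xv] : X != set0 by apply: contraNneq n0 => <-.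
by exists v; rewrite // tE (shift X).
Qed.
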